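(* Let $X$ be a $k$-dimensional simplex with vertex set $S$, and let $\{U_\alpha\}_{\alpha\in S}$ be a simple cover of $X$. Then $\bigcap_{\alpha\in S}U_\alpha$ is not empty.
   Context: The simplex $X$ is regarded as a simplicial complex consisting of all its faces, and identified with its geometric realization when one speaks of subsets and topology. For a vertex $\alpha$ of a simplicial complex $X$, $\operatorname{star}(\alpha)$ is the interior in $X$ of the union of all closed simplices in $X$ having $\alpha$ as a vertex. A simple cover of $X$ is an open cover $\{U_\alpha\}_{\alpha\in S}$ of $X$, indexed by the vertex set $S$, such that $\operatorname{cl}(U_\alpha)\subset\operatorname{star}(\alpha)$ for all $\alpha\in S$, where $\operatorname{cl}$ denotes closure.
   Formalization: Here star(α) is the open star, the union of the relative interiors of all faces having α as a vertex; read literally, the interior of the union of closed simplices containing α is all of X, and then U_a = X for one vertex and U_b empty for the others refutes the claim for k ≥ 1. *)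

(* Defs.v *)
From HB Require Import structures.
From mathcomp Require Import all_boot all_order all_algebra.
From mathcomp Require Import all_classical all_reals all_analysis.
Set Implicit Arguments.
Unset Strict Implicit.
Unset Printing Implicit Defensive.
Import Order.TTheory GRing.Theory Num.Theory.
Import numFieldNormedType.Exports.
Local Open Scope classical_set_scope.
Local Open Scope ring_scope.

Definition affinely_independent (R : realType) (n : nat) (S : finType)
    (v : S -> 'rV[R]_n) : Prop :=
  forall c : S -> R,
    \sum_(a : S) c a = 0 -> \sum_(a : S) c a *: v a = 0 -> forall a, c a = 0.

Definition barycentric_coordinates (R : realType) (n : nat) (S : finType)
    (v : S -> 'rV[R]_n) (t : S -> R) (x : 'rV[R]_n) : Prop :=
  [/\ forall a, 0 <= t a, \sum_(a : S) t a = 1 & x = \sum_(a : S) t a *: v a].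

Definition simplex (R : realType) (n : nat) (S : finType)
    (v : S -> 'rV[R]_n) : set 'rV[R]_n :=
  [set x | exists t : S -> R, barycentric_coordinates v t x].

(* Relative interior of the face spanned by T; it is empty for T empty, so the
   faces of the simplex are exactly the nonempty T. *)
Definition face_interior (R : realType) (n : nat) (S : finType)
    (v : S -> 'rV[R]_n) (T : {set S}) : set 'rV[R]_n :=
  [set x | exists t : S -> R,
    barycentric_coordinates v t x /\ forall a, (0 < t a) = (a \in T)].

(* The open star: the union of the relative interiors of the closed faces having
   a as a vertex.  It is not the topological interior of the union of these
   closed faces: the whole simplex is one of them, so that interior would be the
   whole simplex for every vertex. *)
Definition star (R : realType) (n : nat) (S : finType)
    (v : S -> 'rV[R]_n) (a : S) : set 'rV[R]_n :=
  \bigcup_(T in [set T : {set S} | a \in T]) face_interior v T.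

(* Openness and closure are taken in the subspace topology of the simplex.
   Inclusion of U a in the simplex is required separately, because every point
   outside A is isolated in subspace A. *)
Definition simple_cover (R : realType) (n : nat) (S : finType)
    (v : S -> 'rV[R]_n) (U : S -> set 'rV[R]_n) : Prop :=
  [/\ forall a, U a `<=` simplex v,
      forall a, open (U a : set (subspace (simplex v))),
      simplex v `<=` \bigcup_(a in [set: S]) U a &
      forall a, closure (U a : set (subspace (simplex v))) `<=` star v a].

(* Main.v *)
(* Label the points of a fine grid in the simplex so that the label a of x
   satisfies B(x, d) \subset U_a, where d is a Lebesgue number of the cover.  A
   cluster of grid points within distance d of each other carrying all labels
   then lies in every U_a.  Such a cluster comes from Scarf's combinatorial form
   of Sperner's lemma, which needs no triangulation: given a linear order of a
   finite set V for each i in I and a labelling V -> I, there is a subset A such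
   that every point of V is dominated by A in one of the orders indexed by the
   labels of A.  Let C be the set of labels of A.  When the orders refine the
   coordinates, A clusters near the face C.  Scarf's lemma is applied to the
   given labels shifted cyclically: points near the face C have original labels
   in C only, because U_a misses the face opposite to a and x has label a only
   if B(x, d) is in U_a.  So C is invariant under the cyclic shift and hence is
   everything. *)
From mathcomp Require Import all_boot.
From mathcomp Require Import zify.
Set Implicit Arguments.
Unset Strict Implicit.
Unset Printing Implicit Defensive.

(** * Dominating sets for a family of orders *)

(** Equivalently, no [y] has, in every order at once, a member of [X] strictly below it. *)
Definition dominating (I T : finType) (r : I -> T -> nat) (X : {set T}) :=
  [forall y, exists i, forall x in X, r i y <= r i x].

Section Dominating.
Variables (I T : finType) (r : I -> T -> nat).
Hypothesis r_inj : forall i, injective (r i).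
Implicit Types (X Y : {set T}) (x y z : T).

Lemma dominatingP X :
  reflect (forall y, exists i, forall x, x \in X -> r i y <= r i x)
          (dominating r X).
Proof.
apply: (iffP forallP) => dX y; have := dX y.
  by case/existsP=> i /forall_inP dy; exists i.
by case=> i dy; apply/existsP; exists i; apply/forall_inP.
Qed.

Lemma dominatingS X Y : X \subset Y -> dominating r Y -> dominating r X.
Proof.
move=> /subsetP sXY /dominatingP dY; apply/dominatingP => y.
by have [i dy] := dY y; exists i => x /sXY /dy.
Qed.

(* X is indexed by one element too many, so exactly two indices i, j share their
   minimum m i = m j over X; an extension of X must undercut the minimum at i or
   at j, and the maximal such element is the only choice in either case. *)
Lemma card_dominating_extensions X :
    X != set0 -> #|X|.+1 = #|I| -> dominating r X ->
    (forall k, exists z, forall l, l != k -> exists2 x, x \in X & r l x < r l z) ->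
  #|[set y | (y \notin X) && dominating r (y |: X)]| = 2.
Proof.
case/set0Pn=> x0 x0X cardX /dominatingP domX exM.
pose m l := [arg min_(x < x0 in X) r l x].
have mX l : m l \in X by rewrite /m; case: arg_minnP.
have mP l x : x \in X -> r l (m l) <= r l x.
  by move=> xX; rewrite /m; case: arg_minnP => // y _; apply.
have m_uniq l x : x \in X -> (forall x', x' \in X -> r l x <= r l x') -> x = m l.
  move=> xX xmin; apply: (r_inj (i := l)); apply/eqP.
  by rewrite eqn_leq xmin // mP.
(* [[set~ k]] and [X] have equally many elements, so [m] is injective off [k] once it is onto. *)
have injC k : (forall x, x \in X -> exists2 l, l != k & x = m l) ->
    {in [set~ k] &, injective m}.
  move=> surj; apply/imset_injP.
  have -> : m @: [set~ k] = X.
    apply/setP=> x; apply/imsetP/idP => [[l _ ->] // | /surj[l lk ->]].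
    by exists l; rewrite ?inE.
  by rewrite cardsC1 -cardX.
have [i [j [neij mij]]] : exists i j, i != j /\ m i = m j.
  have ninj : ~~ [forall a, forall b, (m a == m b) ==> (a == b)].
    apply/negP => /forallP inj; have : #|m @: [set: I]| <= #|X|.
      by apply/subset_leq_card/subsetP => _ /imsetP[l _ ->].
    rewrite card_imset ?cardsT -?cardX ?ltnn // => a b mab.
    by apply/eqP; move/forallP: (inj a) => /(_ b); rewrite mab eqxx.
  case/forallPn: ninj => a /forallPn[b]; rewrite negb_imply => /andP[/eqP mab ab].
  by exists a, b.
(* A member of [X] is minimal in the order in which it is itself dominated. *)
have surjX x : x \in X -> exists l, x = m l.
  by move=> xX; have [l lx] := domX x; exists l; apply: m_uniq.
have surjk k : k = i \/ k = j -> forall x, x \in X -> exists2 l, l != k & x = m l.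
  move=> kij x /surjX[l ->]; have [->|] := eqVneq l k; last by exists l.
  by case: kij => ->; [exists j | exists i] => //; rewrite eq_sym.
(* As [X] is dominating, a [z] in [M k] cannot exceed the minimum of [X] in the order [k] too. *)
pose M k := [set z | [forall l, (l != k) ==> (r l (m l) < r l z)]].
have MP k z : reflect (forall l, l != k -> r l (m l) < r l z) (z \in M k).
  by rewrite inE; apply: (iffP forall_inP).
have M_neq0 k : exists z, z \in M k.
  have [z zP] := exM k; exists z; apply/MP => l /zP[x xX]; exact/leq_ltn_trans/mP.
have M_ext k z : k = i \/ k = j -> z \in M k ->
    (forall z', z' \in M k -> r k z' <= r k z) ->
    (z \notin X) && dominating r (z |: X).
  move=> kij /MP zM zmax; apply/andP; split.
    by apply/negP=> /(surjk k kij)[l lk zml]; have := zM l lk; rewrite zml ltnn.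
  have zk : r k z <= r k (m k).
    have [l lz] := domX z; have [<-|lk] := eqVneq l k; first exact: lz.
    by have := zM l lk; rewrite ltnNge lz.
  apply/dominatingP => y; have [yM|] := boolP (y \in M k).
    exists k => x /setU1P[->|xX]; first exact: zmax.
    exact: leq_trans (zmax _ yM) (leq_trans zk (mP _ _ xX)).
  rewrite inE => /forallPn[l]; rewrite negb_imply -leqNgt => /andP[lk yl].
  exists l => x /setU1P[->|xX]; first exact: leq_trans yl (ltnW (zM _ lk)).
  exact: leq_trans yl (mP _ _ xX).
have ext_M y : y \notin X -> dominating r (y |: X) ->
    exists2 k, k = i \/ k = j & y \in M k /\ forall z', z' \in M k -> r k z' <= r k y.
  move=> yX /dominatingP dy; have [k ky] := dy y.
  have neX x : x \in X -> x <> y by move=> xX xy; rewrite -xy xX in yX.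
  (* In the order [k] the minimum of [y |: X] is [y], so each member of [X] is minimal in another
     order; [m] is then injective off [k], and [m i = m j] forces [k] to be [i] or [j]. *)
  have surj x : x \in X ->
      exists l, [/\ l != k, x = m l & forall x', x' \in y |: X -> r l x <= r l x'].
    move=> xX; have [l lx] := dy x; exists l; split=> //.
      apply/eqP => lk; rewrite lk in lx; case: (neX x xX); apply: (r_inj (i := k)).
      by apply/eqP; rewrite eqn_leq lx ?setU11 // ky // setU1r.
    by apply: m_uniq => // x' x'X; apply: lx; rewrite setU1r.
  have inj : {in [set~ k] &, injective m}.
    by apply: injC => x /surj[l [lk xl _]]; exists l.
  have yM : y \in M k.
    apply/MP => l lk; have [l' [l'k mll' l'min]] := surj _ (mX l).
    have ll' : l = l' by apply: inj; rewrite ?inE.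
    rewrite ltn_neqAle -ll' in l'min *; rewrite l'min ?setU11 // andbT.
    by apply/eqP => /r_inj; apply: neX.
  exists k; last first.
    split=> // z /MP zM; have [l lz] := dy z; have [<-|lk] := eqVneq l k.
      by apply: lz; rewrite setU11.
    by have := zM l lk; rewrite ltnNge lz // setU1r.
  have [->|ik] := eqVneq i k; first by left.
  have [->|jk] := eqVneq j k; first by right.
  by case/eqP: neij; apply: inj; rewrite ?inE.
have maxM k : exists2 z, z \in M k & forall z', z' \in M k -> r k z' <= r k z.
  have [z zM] := M_neq0 k; case: (@arg_maxnP _ z (mem (M k)) (r k) zM) => y yM ymax.
  by exists y.
have [yi yiM yimax] := maxM i; have [yj yjM yjmax] := maxM j.
(* An element of both [M i] and [M j] would exceed the minimum of [X] in every order. *)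
have neyij : yi != yj.
  apply/eqP => yij; rewrite -yij in yjM; have [l lz] := domX yi.
  have lmz : r l yi <= r l (m l) by apply: lz.
  have [li|li] := eqVneq l i; last by move/MP: yiM => /(_ l li); rewrite ltnNge lmz.
  by move/MP: yjM => /(_ l); rewrite ltnNge lmz li => /(_ neij).
have -> : [set y | (y \notin X) && dominating r (y |: X)] = [set yi; yj].
  apply/setP => y; rewrite !inE; apply/idP/orP => [/andP[yX] | [] /eqP ->].
  - case/(ext_M y yX) => k kij [yM ymax]; case: kij => kE; rewrite kE in yM ymax.
      by left; apply/eqP/(r_inj (i := i))/eqP; rewrite eqn_leq yimax ?ymax.
    by right; apply/eqP/(r_inj (i := j))/eqP; rewrite eqn_leq yjmax ?ymax.
  - by apply: (M_ext i) => //; left.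
  - by apply: (M_ext j) => //; right.
by rewrite cards2 neyij.
Qed.

End Dominating.

(** * Scarf's combinatorial lemma *)

(* Parity argument on sets with #|I| elements (rooms) and #|I| - 1 elements
   (doors); the slack elements s i, minimal in the order i and maximal in the
   others, play the role of the boundary faces. *)
Section Scarf.
Variables (I T : finType) (r : I -> T -> nat) (s : I -> T) (c : T -> I).
Hypothesis r_inj : forall i, injective (r i).
Hypothesis r_slack_min : forall i x, r i (s i) <= r i x.
Hypothesis r_slack_max :
  forall i j x, i != j -> x \notin codom s -> r i x < r i (s j).
Hypothesis s_neq_setT : exists x, x \notin codom s.
Hypothesis c_slack : cancel s c.

Let s_inj : injective s. Proof. exact: can_inj c_slack. Qed.

(** In the order [i] where a non-slack [v] is dominated, [v] would be at most the minimum [s i],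
    hence equal to it. *)
Lemma not_dominating_slacks (X : {set T}) : codom s \subset X -> ~~ dominating r X.
Proof.
move=> sX; apply/negP => /dominatingP dX; have [v vs] := s_neq_setT.
have [i iv] := dX v; have := iv (s i); rewrite (subsetP sX) ?codom_f // => /(_ isT) vi.
case/negP: vs; suff -> : v = s i by apply: codom_f.
by apply: (r_inj (i := i)); apply/eqP; rewrite eqn_leq vi r_slack_min.
Qed.

(** The door of all slacks but [s i0] extends only by the [i0]-largest non-slack element, since
    adding [s i0] would complete the slacks. Any other [X] here contains a non-slack element, which
    lies below [s k] in every order but [k], so [card_dominating_extensions] gives two. *)
Lemma odd_card_dominating_extensions (i0 : I) (X : {set T}) :
    c @: X = [set~ i0] -> #|X|.+1 = #|I| -> dominating r X ->
  odd #|[set y | (y \notin X) && dominating r (y |: X)]| = (X == s @: [set~ i0]).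
Proof.
move=> cX cardX domX; have [XE|nX] := eqVneq X (s @: [set~ i0]).
  have [v vs] := s_neq_setT.
  have [y ys ymax] : exists2 y, y \notin codom s &
      forall z, z \notin codom s -> r i0 z <= r i0 y.
    by case: (@arg_maxnP _ v (fun z => z \notin codom s) (r i0) vs) => y; exists y.
  suff -> : [set y | (y \notin X) && dominating r (y |: X)] = [set y].
    by rewrite cards1.
  have slackX j : (s j \in X) = (j != i0).
    by rewrite XE mem_imset // !inE.
  have Xslack x : x \in X -> exists2 j, j != i0 & x = s j.
    by rewrite XE => /imsetP[j]; rewrite !inE; exists j.
  apply/setP=> z; rewrite !inE; apply/andP/eqP => [[zX dz]|->]; last first.
    split.
      by apply/negP => /Xslack[j _ ys']; rewrite ys' codom_f in ys.
    apply/dominatingP => x; have [/codomP[j ->]|xs] := boolP (x \in codom s).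
      by exists j => ? _.
    exists i0 => ? /setU1P[->|/Xslack[j ji0 ->]]; first exact: ymax.
    by rewrite ltnW // r_slack_max // eq_sym.
  have zs : z \notin codom s.
    apply/negP => /codomP[j zj]; move: dz; apply/negP; apply: not_dominating_slacks.
    apply/subsetP => _ /codomP[l ->]; rewrite !inE slackX.
    have [->|_] := eqVneq l i0; last by rewrite orbT.
    rewrite orbF zj; move: zX; rewrite zj slackX negbK.
    by move=> /eqP ->.
  have [i iy] := dominatingP _ _ dz y.
  have ii0 : i = i0.
    apply/eqP; apply: contraNT ys => ii0.
    suff -> : y = s i by apply: codom_f.
    apply: (r_inj (i := i)); apply/eqP.
    by rewrite eqn_leq r_slack_min iy // !inE slackX ii0 orbT.
  apply: (r_inj (i := i0)); apply/eqP; rewrite eqn_leq ymax //.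
  by rewrite -ii0 iy // setU11.
have [x0 x0X x0s] : exists2 x, x \in X & x \notin codom s.
  apply/exists_inP; apply: contraR nX; rewrite negb_exists_in => /forall_inP sX.
  rewrite eqEcard card_imset // cardsC1 -cardX leqnn andbT.
  apply/subsetP => x xX; have := sX x xX; rewrite negbK => /codomP[j xj].
  rewrite xj imset_f // -cX; apply/imsetP; exists x => //.
  by rewrite xj c_slack.
rewrite card_dominating_extensions //; first by apply/set0Pn; exists x0.
move=> k; exists (s k) => l lk; exists x0 => //; exact: r_slack_max.
Qed.

(** If removing [y] leaves each label but [i0] exactly once, then [c y] is not [i0] and repeats the
    label of a single [y']; the removable elements are [y] and [y']. *)
Lemma even_card_relabel (i0 : I) (X : {set T}) :
    #|X| = #|I| -> c @: X != [set: I] ->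
  ~~ odd #|[set y in X | c @: (X :\ y) == [set~ i0]]|.
Proof.
move=> cardX cX; have [->|/set0Pn[y]] :=
  eqVneq [set y in X | c @: (X :\ y) == [set~ i0]] set0.
  by rewrite cards0.
rewrite inE => /andP[yX /eqP cXy].
have cy : c y \in c @: (X :\ y).
  rewrite cXy !inE; apply: contraNneq cX => cy.
  rewrite -(setD1K yX) imsetU1 cXy cy; apply/eqP/setP => i; rewrite !inE.
  by case: eqP.
have inj : {in X :\ y &, injective c}.
  apply/imset_injP; rewrite cXy cardsC1 -cardX (cardsD1 y X) yX.
  by [].
case/imsetP: (cy) => y' y'X cyy'.
have yy' : y != y' by move: y'X; rewrite !inE eq_sym => /andP[].
suff -> : [set y in X | c @: (X :\ y) == [set~ i0]] = [set y; y'] by rewrite cards2 yy'.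
apply/setP => z; rewrite !inE.
apply/andP/orP => [[zX /eqP cXz]|[]/eqP->]; last 2 first.
- by rewrite yX cXy.
- have y'X' : y' \in X by move: y'X; rewrite inE => /andP[].
  rewrite y'X' -cXy; split=> //; apply/eqP/setP => i.
  apply/imsetP/imsetP => -[x]; rewrite !inE => /andP[xy xX] ->.
    have [->|xy0] := eqVneq x y; first by exists y'; rewrite // !inE eq_sym yy'.
    by exists x; rewrite // !inE xy0.
  have [->|xy0] := eqVneq x y'; first by exists y; rewrite // !inE yy'.
  by exists x; rewrite // !inE xy0.
have [->|zy] := eqVneq z y; first by left.
right; apply/eqP.
have : c z \in c @: (X :\ z).
  by rewrite cXz -cXy imset_f // !inE zy.
case/imsetP => x; rewrite !inE => /andP[xz xX] czx.
have [xy|xy] := eqVneq x y.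
  by apply: inj => //; rewrite ?inE ?zy // czx xy cyy'.
by case/eqP: xz; apply: inj; rewrite ?inE ?zy ?xy.
Qed.

(** Pairs of a door inside a room are counted twice. By doors the total is odd, only [s @:
    [set~ i0]] having an odd number of extensions; rooms missing a label contribute evenly, so some
    room carries all labels. *)
Lemma scarf_slacks :
  exists X : {set T}, [/\ dominating r X, #|X| = #|I| & c @: X = [set: I]].
Proof.
have [v _] := s_neq_setT; pose i0 := c v.
pose room X := dominating r X && (#|X| == #|I|).
pose door X := [&& dominating r X, c @: X == [set~ i0] & #|X|.+1 == #|I|].
have count : \sum_(X | room X) #|[set y in X | c @: (X :\ y) == [set~ i0]]| =
             \sum_(Z | door Z) #|[set y | (y \notin Z) && dominating r (y |: Z)]|.
  under eq_bigr do rewrite -sum1dep_card.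
  under [RHS]eq_bigr do rewrite -sum1dep_card.
  rewrite (exchange_big_dep xpredT) // [RHS](exchange_big_dep xpredT) //=.
  apply: eq_bigr => y _.
  rewrite (reindex_onto (fun Z => y |: Z) (fun X => X :\ y)) /=; last first.
    by move=> X /and3P[_ yX _]; rewrite setD1K.
  apply: eq_bigl => Z; rewrite setU11 /=.
  have [yZ|yZ] := boolP (y \in Z).
    rewrite /= andbF; apply/negP => /andP[_ /eqP ZE].
    by move: yZ; rewrite -ZE !inE eqxx.
  rewrite setU1K // eqxx andbT /room /door cardsU1 yZ add1n.
  have [dyZ|] := boolP (dominating r (y |: Z)); last by rewrite !andbF.
  by rewrite (dominatingS _ dyZ) ?subsetUr //= andbT andbC.
have oddS (J : finType) (P : pred J) (F : J -> nat) :
    odd (\sum_(j | P j) F j) -> exists2 j, P j & odd (F j).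
  move=> oF; apply/exists_inP; apply: contraLR oF.
  rewrite negb_exists_in => /forall_inP eF.
  by elim/big_rec: _ => // j n Pj; rewrite oddD (negbTE (eF j Pj)).
have : odd (\sum_(X | room X) #|[set y in X | c @: (X :\ y) == [set~ i0]]|).
  have door0 : door (s @: [set~ i0]).
    rewrite /door card_imset // cardsC1 prednK ?eqxx ?andbT; last first.
      by apply/card_gt0P; exists i0.
    rewrite -imset_comp (eq_imset (g := id)) ?imset_id ?eqxx ?andbT //.
    apply/dominatingP => x; have [/codomP[j ->]|xs] := boolP (x \in codom s).
      by exists j.
    exists i0 => ? /imsetP[j]; rewrite !inE => ji0 ->.
    by rewrite ltnW // r_slack_max // eq_sym.
  have oddE Z : door Z -> odd #|[set y | (y \notin Z) && dominating r (y |: Z)]| =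
      (Z == s @: [set~ i0]).
    by case/and3P => dZ /eqP cZ /eqP cardZ; apply: odd_card_dominating_extensions.
  rewrite count (bigD1 _ door0) /= oddD oddE // eqxx /=.
  apply/negP => /oddS[Z /andP[dZ Zs]]; by rewrite oddE // (negbTE Zs).
case/oddS=> X /andP[dX /eqP cardX] oX; exists X; split=> //.
by apply/eqP; apply: contraLR oX => /even_card_relabel ->.
Qed.

End Scarf.

(** Slacks [inr i] are adjoined. An order [i] dominating a genuine [y] excludes [inr i] from the
    room, so the label [i] is carried there by a genuine element. *)
Lemma scarf (I V : finType) (r : I -> V -> nat) (c : V -> I) (v0 : V) :
    (forall i, injective (r i)) ->
  exists A : {set V},
    forall y, exists2 i, i \in c @: A & forall x, x \in A -> r i y <= r i x.
Proof.
move=> r_inj; pose B i := \max_v r i v.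
(* Ranks of [V] are shifted by one to free [0] for [inr i]; the other slacks lie above [B i + 1],
   kept distinct by [enum_rank]. *)
pose r' i (x : V + I) := match x with
  | inl v => (r i v).+1
  | inr j => if j == i then 0 else (B i + enum_rank j).+2 end.
pose c' (x : V + I) := match x with inl v => c v | inr i => i end.
have rB i v : r i v <= B i by rewrite /B; apply: leq_bigmax.
have inl_slack v : inl v \notin codom (@inr V I) by apply/codomP => -[].
have [|||||X [/dominatingP dX cardX cX]] := @scarf_slacks I (V + I)%type r' inr c'.
- move=> i [v|j] [w|l] /=.
  + by case=> /r_inj ->.
  + by case: eqP => // _ [] rv; have := rB i v; lia.
  + by case: eqP => // _ [] rw; have := rB i w; lia.
  + by do 2![case: eqP => [->|_] //]; case=> /addnI/ord_inj/enum_rank_inj ->.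
- by move=> i x; rewrite /= eqxx.
- move=> i j [v|l] ij; last by rewrite codom_f.
  by move=> _ /=; rewrite eq_sym (negbTE ij) !ltnS (leq_trans (rB i v)) ?leq_addr.
- by exists (inl v0).
- by [].
have c'_inj : {in X &, injective c'} by apply/imset_injP; rewrite cX cardsT cardX.
exists [set v | inl v \in X] => y; have [i iy] := dX (inl y).
have iX : inr i \notin X by apply/negP => /iy; rewrite /= eqxx.
exists i; last by move=> x; rewrite inE => /iy.
have : i \in c' @: X by rewrite cX.
case/imsetP => -[v|j] xX /= ij; last by rewrite ij xX in iX.
rewrite ij.
by apply/imsetP; exists v; rewrite ?inE.
Qed.

(** * A discrete KKM theorem on grid points *)

Lemma iter_ordS n k (i : 'I_n) : iter k (@ordS n) i = (i + k) %% n :> nat.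
Proof.
elim: k => [|k IH] /=; first by rewrite addn0 modn_small.
by rewrite IH -addn1 modnDml addn1 addnS.
Qed.

Lemma ordS_closed n (C : {set 'I_n}) (i j : 'I_n) :
  (forall l, l \in C -> ordS l \in C) -> i \in C -> j \in C.
Proof.
move=> CS iC; suff -> : j = iter (j + (n - i)) (@ordS n) i.
  by elim: (_ + _) => //= k /CS.
apply: val_inj; rewrite /= iter_ordS addnCA subnKC ?(ltnW (ltn_ord i)) //.
by rewrite modnDr modn_small.
Qed.

Lemma discrete_kkm (n N : nat) (lab : {ffun 'I_n.+1 -> 'I_N.+1} -> 'I_n.+1) :
    (forall p : {ffun 'I_n.+1 -> 'I_N.+1}, \sum_i p i = N -> n < p (lab p)) ->
  exists2 p : {ffun 'I_n.+1 -> 'I_N.+1}, \sum_i p i = N &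
    forall i, exists q : {ffun 'I_n.+1 -> 'I_N.+1},
      [/\ \sum_i q i = N, lab q = i &
          forall j, p j <= q j + n /\ q j <= p j + n].
Proof.
move=> labP; pose V := {p : {ffun 'I_n.+1 -> 'I_N.+1} | \sum_i p i == N}.
have mkV (q : 'I_n.+1 -> nat) : \sum_i q i = N ->
    exists p : V, forall i, val p i = q i :> nat.
  move=> qN; have qE i : [ffun i => inord (q i) : 'I_N.+1] i = q i :> nat.
    by rewrite ffunE inordK // ltnS -qN (bigD1 i) //= leq_addr.
  have qV : \sum_i [ffun i => inord (q i) : 'I_N.+1] i == N.
    by rewrite (eq_bigr q) ?qN.
  by exists (exist (fun p : {ffun 'I_n.+1 -> 'I_N.+1} => \sum_i p i == N) _ qV).
have [v0 _] : exists p : V, forall i, val p i = (if i == ord0 then N else 0) :> nat.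
  by apply: mkV; rewrite -big_mkcond big_pred1_eq.
(* The order by coordinate [i], with ties broken by the enumeration of [V]. *)
pose r (i : 'I_n.+1) (p : V) := val p i * #|{: V}| + enum_rank p.
have r_mono i p q : r i p <= r i q -> val p i <= val q i.
  rewrite /r; have rq : enum_rank q < #|{: V}| by [].
  case: (leqP (val p i)) => // ltqp rk.
  have := leq_trans (leq_add (leq_mul ltqp (leqnn #|{: V}|)) (leq0n (enum_rank p))) rk.
  by rewrite addn0 mulSn addnC leq_add2l leqNgt rq.
have r_inj i : injective (r i).
  move=> p q rpq; have pq : val p i = val q i.
    by apply/val_inj/eqP; rewrite eqn_leq !r_mono // rpq.
  by move: rpq; rewrite /r pq => /addnI/ord_inj/enum_rank_inj.
have [A domA] := scarf (fun p : V => ord_pred (lab (val p))) v0 r_inj.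
set C := _ @: A in domA.
have [i0 i0C _] := domA v0; case/imsetP: (i0C) => x0 x0A _.
(* The value [0] off [C] makes [close] bound those coordinates of [A] by [n]. *)
pose m i := if i \in C then val [arg min_(x < x0 in A) val x i] i : nat else 0.
have mP i x : x \in A -> m i <= val x i.
  by rewrite /m => xA; case: ifP => // _; case: arg_minnP => // y _; apply.
(* Otherwise a grid point with coordinates at least [m i + 1] on [C], the surplus placed at [i0], is
   dominated in no order of [C]. *)
have m_sum : N <= \sum_i m i + n.
  rewrite leqNgt; apply/negP => ltmN.
  have leN : \sum_(i in C) (m i).+1 <= N.
    apply: leq_trans ltmN; rewrite -addnS (eq_bigr (fun i => m i + 1));
      last by move=> *; rewrite addn1.
    rewrite big_split /= sum1_card leq_add //;
      last by rewrite (leq_trans (max_card _)) ?card_ord.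
    by rewrite [leqRHS](bigID (mem C)) /= leq_addr.
  pose q i := (if i \in C then (m i).+1 else 0)
    + (if i == i0 then N - \sum_(i in C) (m i).+1 else 0).
  have [|p pE] := mkV q.
    by rewrite big_split /= -!big_mkcond /= big_pred1_eq subnKC.
  have [i iC ip] := domA p.
  suff : (m i).+1 <= m i by rewrite ltnn.
  have -> : (m i).+1 <= m i = (m i < val [arg min_(x < x0 in A) val x i] i).
    by rewrite {2}/m iC.
  case: arg_minnP => // x xA _; apply: leq_trans (r_mono _ _ _ (ip x xA)).
  by rewrite pE /q iC leq_addr.
have close x i : x \in A -> val x i <= m i + n.
  move=> xA; have xN : \sum_i val x i = N by apply/eqP/(valP x).
  have : \sum_(j | j != i) m j <= \sum_(j | j != i) val x j.
    by apply: leq_sum => j _; apply: mP.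
  by move: m_sum xN; rewrite (bigD1 i) //= [X in X = N](bigD1 i) //=; lia.
(* Were the unshifted label of [x] outside [C], its coordinate there would be at most [n], against
   [labP]. *)
have CS i : i \in C -> ordS i \in C.
  case/imsetP => x xA ->; rewrite ord_predK; apply: contraT => labC.
  have xN : \sum_i val x i = N by apply/eqP/(valP x).
  by have := close x (lab (val x)) xA; rewrite /m (negbTE labC) add0n leqNgt labP.
exists (val x0); first by apply/eqP/(valP x0).
move=> i; have : ord_pred i \in C by apply: ordS_closed CS i0C.
case/imsetP => x xA /(can_inj (@ord_predK _)) ->; exists (val x); split=> //.
  by apply/eqP/(valP x).
move=> j; have [mx mx0] := (mP j x xA, mP j x0 x0A).
by split; [apply: leq_trans (close x0 j x0A) _ | apply: leq_trans (close x j xA) _];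
  rewrite leq_add2r.
Qed.

Require Import Defs.
From mathcomp Require Import all_boot all_order all_algebra.
From mathcomp Require Import all_classical all_reals all_analysis.
From mathcomp Require Import lra.
Import Order.TTheory GRing.Theory Num.Theory.
Import numFieldNormedType.Exports.
Local Open Scope classical_set_scope.
Local Open Scope ring_scope.

(** * From the grid to open covers of the standard simplex *)

Lemma lebesgue_number (R : realType) (M : pseudoMetricType R) (I : Type)
    (K : set M) (W : I -> set M) :
    compact K -> (forall i, open (W i)) -> K `<=` \bigcup_(i in [set: I]) W i ->
  exists2 d : R, 0 < d & forall x, K x -> exists i, ball x d `<=` W i.
Proof.
move=> /compact_near_coveringP cK oW KW.
have Kd : \forall e \near (0 : R)^'+, forall x, K x -> exists i, ball x e `<=` W i.
  apply: cK; move=> x /KW[i _ Wix].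
  have /nbhs_ballP[e /= e0 eW] := open_nbhs_nbhs (conj (oW i) Wix).
  exists (ball x (e / 2), [set d | d < e / 2]) => /=.
    split; first by apply: nbhsx_ballx; rewrite divr_gt0.
    by apply: nbhs_right_lt; rewrite divr_gt0.
  move=> [y d] /= [xy de]; exists i => z yz; apply: eW.
  by rewrite (splitr e); apply: ball_triangle xy (le_ball (ltW de) yz).
have [d [d0 dK]] := filter_ex (filterI (nbhs_right_gt (0 : R)) Kd).
by exists d.
Qed.

Definition std_simplex (R : realType) (n : nat) : set 'rV[R]_n :=
  [set t | (forall i, 0 <= t ord0 i) /\ \sum_i t ord0 i = 1].

Lemma compact_std_simplex (R : realType) (n : nat) : compact (@std_simplex R n).
Proof.
have cube := @rV_compact R n (fun=> `[0, 1]%classic) (fun=> @segment_compact _ _ _).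
apply: (subclosed_compact _ cube).
- have -> : @std_simplex R n =
      \bigcap_(i in [set: 'I_n]) ((fun t : 'rV[R]_n => t ord0 i) @^-1` [set x | 0 <= x])
      `&` (fun t : 'rV[R]_n => \sum_i t ord0 i) @^-1` [set x | x = 1].
    apply/seteqP; split=> t [/= t0 t1]; split=> // i; last exact: t0.
    by move=> _; apply: t0.
  apply: closedI.
    apply: closed_bigI => i _; apply: preimage_closed (@closed_ge _ 0) => t _.
    exact: coord_continuous.
  apply: preimage_closed (@closed_eq _ 1) => t _.
  apply: (@continuous_big R _ +%R 0 xpredT); first exact: add_continuous.
  by move=> i _; apply: coord_continuous.
- move=> t [t0 t1] i /=; rewrite in_itv /= t0 -t1 (bigD1 i) //= lerDl.
  by apply: sumr_ge0 => j _; apply: t0.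
Qed.

Lemma open_kkm (R : realType) (n : nat) (W : 'I_n.+1 -> set 'rV[R]_n.+1) :
    (forall i, open (W i)) ->
    @std_simplex R n.+1 `<=` \bigcup_(i in [set: 'I_n.+1]) W i ->
    (forall t i, std_simplex t -> W i t -> t ord0 i != 0) ->
  exists2 t, std_simplex t & forall i, W i t.
Proof.
move=> oW coverW W0.
have [d d0 dW] := lebesgue_number (@compact_std_simplex R n.+1) oW coverW.
(* Fine enough that [n] grid steps stay below the Lebesgue number [d]. *)
pose N := (Num.Def.archi_bound (n%:R / d)).+1.
have N0 : 0 < N%:R :> R by rewrite ltr0n.
have Nd (m : nat) : (m <= n)%N -> m%:R / N%:R < d.
  move=> mn; rewrite ltr_pdivrMr // mulrC -ltr_pdivrMr //.
  apply: (@le_lt_trans _ _ (n%:R / d)); first by rewrite ler_pM2r ?invr_gt0 // ler_nat.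
  apply: lt_trans (_ : (Num.Def.archi_bound (n%:R / d))%:R < _); last by rewrite ltr_nat.
  by apply: archi_boundP; rewrite divr_ge0 // ltW.
pose pt (p : {ffun 'I_n.+1 -> 'I_N.+1}) : 'rV[R]_n.+1 := \row_i ((p i)%:R / N%:R).
have ptP (p : {ffun 'I_n.+1 -> 'I_N.+1}) : (\sum_i p i)%N = N -> std_simplex (pt p).
  move=> pN; split=> [i|]; first by rewrite mxE divr_ge0.
  under eq_bigr do rewrite mxE.
  by rewrite -mulr_suml -natr_sum pN divff ?gt_eqF.
have [lab labP] : {lab : {ffun 'I_n.+1 -> 'I_N.+1} -> 'I_n.+1 &
    forall p : {ffun 'I_n.+1 -> 'I_N.+1}, (\sum_i p i)%N = N ->
      ball (pt p) d `<=` W (lab p)}.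
  apply: (@choice _ _ (fun (p : {ffun 'I_n.+1 -> 'I_N.+1}) i =>
    (\sum_i p i)%N = N -> ball (pt p) d `<=` W i)) => p.
  have [pN|npN] := pselect ((\sum_i p i)%N = N); last by exists ord0.
  by have [i iW] := dW _ (ptP p pN); exists i.
have [p pN|p pN pP] := @discrete_kkm n N lab.
  rewrite ltnNge; apply/negP => pn; set i := lab p in pn *.
  (* If [n = 0], then [p i] would be [0] while the coordinates sum to [N > 0]. *)
  have [j ji] : exists j, j != i.
    apply/existsP; apply: contraLR isT; rewrite negb_exists => /forallP alli.
    have ji j : j = i by apply/eqP; rewrite -[_ == _]negbK alli.
    have n0 : n = 0%N by have := congr1 val (etrans (ji ord_max) (esym (ji ord0))).
    have /eqP pi0 : p i == 0%N :> nat by rewrite -leqn0 (leq_trans pn) // n0.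
    by move: pN; rewrite big1 // => j _; rewrite (ji j).
  set a := (p i)%:R / N%:R : R.
  have a0 : 0 <= a by rewrite divr_ge0.
  (* Moving the mass of vertex [i] to [j] reaches the facet opposite [i] within sup distance
     [a < d]: the point lies in [W i], against [W0]. *)
  pose t := pt p + a *: (delta_mx 0 j - delta_mx 0 i).
  have tE l : t ord0 l = (p l)%:R / N%:R + a * ((l == j)%:R - (l == i)%:R).
    by rewrite !mxE eqxx /=.
  have ad : a < d by apply: Nd.
  have tK : std_simplex t.
    have [pt0 pt1] := ptP p pN; split=> [l|].
      rewrite tE; have [->|li] := eqVneq l i.
        by rewrite eq_sym (negbTE ji) sub0r mulrN1 subrr.
      by rewrite subr0 addr_ge0 ?mulr_ge0 // divr_ge0.
    under eq_bigr do rewrite tE.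
    rewrite big_split /= -mulr_sumr sumrB.
    have sum1 k : \sum_l ((l == k :> 'I_n.+1)%:R) = 1 :> R.
      by rewrite (bigD1 k) //= eqxx big1 ?addr0 // => l /negbTE ->.
    rewrite !sum1 subrr mulr0 addr0; apply: etrans pt1.
    by apply: eq_bigr => l _; rewrite mxE.
  have : t ord0 i != 0.
    apply: W0 tK _; apply: labP => //. split=> // k l; rewrite (ord1 k).
    rewrite /ball /= tE mxE opprD addNKr normrN normrM ger0_norm //.
    apply: le_lt_trans ad; rewrite ler_piMr //.
    by case: (l == j); case: (l == i); rewrite ?subrr ?subr0 ?sub0r ?normrN ?normr1 ?normr0.
  by rewrite tE eqxx [i == j]eq_sym (negbTE ji) sub0r mulrN1 subrr eqxx.
exists (pt p); first exact: ptP.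
move=> i; have [q [qN <- pq]] := pP i; apply: (labP q qN); split=> // k l.
rewrite (ord1 k) /ball /= !mxE -mulrBl normrM [`|N%:R^-1|]ger0_norm ?invr_ge0 //.
have [pql qpl] := pq l.
have := Nd n (leqnn n); apply: le_lt_trans; rewrite ler_pM2r ?invr_gt0 //.
rewrite ler_norml; move: pql qpl; rewrite -!(ler_nat R) !natrD; lra.
Qed.

(** * Transfer to an arbitrary simplex by barycentric coordinates *)

Theorem corollary5 (R : realType) (n k : nat) (S : finType)
    (v : S -> 'rV[R]_n) (U : S -> set 'rV[R]_n) :
  #|S| = k.+1 -> affinely_independent v -> simple_cover v U ->
  \bigcap_(a in [set: S]) U a !=set0.
Proof.
move=> cardS indep [Usimplex oU coverU clU].
pose rk (a : S) : 'I_k.+1 := cast_ord cardS (enum_rank a).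
pose e (i : 'I_k.+1) : S := enum_val (cast_ord (esym cardS) i).
have eK : cancel e rk by move=> i; rewrite /rk /e enum_valK cast_ordKV.
have rkK : cancel rk e by move=> a; rewrite /rk /e cast_ordK enum_rankK.
pose phi (t : 'rV[R]_k.+1) := \sum_a t ord0 (rk a) *: v a.
have phi_cont : continuous phi.
  apply: (@continuous_big 'rV[R]_n S +%R 0 xpredT); first exact: add_continuous.
  by move=> a _ t; apply: continuousZr_tmp; apply: coord_continuous.
have phi_bary t : std_simplex t ->
    barycentric_coordinates v (fun a => t ord0 (rk a)) (phi t).
  case=> t0 t1; split=> //; rewrite -t1 [RHS](reindex rk) //.
  by exists e => ? _; [apply: rkK | apply: eK].
have bary_uniq x s t a : barycentric_coordinates v s x ->
    barycentric_coordinates v t x -> s a = t a.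
  case=> _ s1 sx [_ t1 tx]; apply/eqP; rewrite -subr_eq0; apply/eqP.
  apply: (indep (fun a => s a - t a)).
    by rewrite sumrB s1 t1 subrr.
  under eq_bigr do rewrite scalerBl.
  by rewrite sumrB -sx -tx subrr.
(* Ambient open sets with the same trace on the simplex have open preimages under [phi]. *)
have [V VP] : {V : S -> set 'rV[R]_n &
    forall a, open (V a) /\ V a `&` simplex v = U a `&` simplex v}.
  apply: (@choice _ _ (fun a V => open V /\ V `&` simplex v = U a `&` simplex v)) => a.
  by have /open_subspaceP[V oV VU] := oU a; exists V.
have phi_simplex t : std_simplex t -> simplex v (phi t).
  by move=> tK; exists (fun a => t ord0 (rk a)); apply: phi_bary.
have VU t a : std_simplex t -> V a (phi t) -> U a (phi t).
  move=> tK Vt; have [_ VUa] := VP a.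
  by have [] : (U a `&` simplex v) (phi t) by rewrite -VUa; split=> //; apply: phi_simplex.
have [|||t tK tW] := @open_kkm R k (fun i => phi @^-1` V (e i)).
- by move=> i; apply: open_comp (VP (e i)).1 => ? _; apply: phi_cont.
- move=> t tK; have [a _ Ua] := coverU _ (phi_simplex t tK).
  exists (rk a) => //=; rewrite rkK; have [_ VUa] := VP a.
  by have [] : (V a `&` simplex v) (phi t) by rewrite VUa; split=> //; apply: phi_simplex.
- move=> t i tK /VU => /(_ tK) Ut.
  (* [U (e i)] lies in the open star, where coordinate [e i] is positive; affine independence
     identifies the coordinates [s] with those given by [t]. *)
  have [T /= eT [s [sP sT]]] := clU _ _ (@subset_closure (subspace (simplex v)) _ _ Ut).
  have := sT (e i); rewrite eT (bary_uniq _ _ _ _ sP (phi_bary t tK)) eK.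
  by move=> /gt_eqF ->.
exists (phi t) => a _; apply: VU => //; have := tW (rk a); by rewrite /= rkK.
Qed.
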